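(* Let $Q$ be a polynomial ring over a field, let $I$ be a proper monomial ideal of $Q$ with minimal monomial generators $m_1,\dots,m_q$, set $l=\operatorname{Scarf-number}(I)$ and assume $l\neq\infty$. Then there exist indices $i_1<\dots<i_l$ in $\{1,\dots,q\}$ such that $\mathcal{T}_{i_1,\dots,i_l}$ is a pivot resolution of $Q/I$. Moreover, for any pivot resolution $\mathcal{F}$ of $Q/I$, we have $$\binom{q}{i}-\binom{q-l}{i-l}=\operatorname{rank}(\mathcal{T}_{i_1,\dots,i_l})_i\le\operatorname{rank}(\mathcal{F})_i\le\binom{q}{i}$$ for any index $i$.
   Context: Notation. $[q]=\{1,\dots,q\}$, $\mathcal{P}([q])$ is its power set. For $A\subseteq[q]$ put $m_A=\operatorname{lcm}(m_i : i\in A)$, with $m_\emptyset=1$. Binomial coefficients $\binom{a}{b}$ with $b<0$ or $b>a$ are $0$. Scarf number. $\operatorname{Scarf-number}(I)=\inf\{t\in\mathbb{N} : \exists\,\tau,\tau'\in\mathcal{P}([q])\text{ with }\tau\ne\tau',\ |\tau|=t,\ m_\tau=m_{\tau'}\}$ (equal to $\infty$ if no such $t$ exists). Taylor resolution. $\mathcal{T}$ is the complex of free $Q$-modules whose degree-$i$ component has basis $\{\epsilon_\tau : \tau\in\mathcal{P}([q]),\ |\tau|=i\}$, with differential $\partial(\epsilon_\tau)=\sum_{j\in\tau}(-1)^{|\{k\in\tau : k<j\}|}\frac{m_\tau}{m_{\tau\setminus\{j\}}}\epsilon_{\tau\setminus\{j\}}$. It is a free resolution of $Q/I$. Pivot complexes.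 A pivot complex of $Q/I$ is either $\mathcal{T}$ itself or, for some integer $l\ge2$ and $i_1<\dots<i_l$ in $[q]$, the subcomplex $\mathcal{T}_{i_1,\dots,i_l}$ of $\mathcal{T}$ spanned over $Q$ by the $\epsilon_\sigma$ with $\sigma\nsupseteq\{i_1,\dots,i_l\}$. A pivot resolution of $Q/I$ is a pivot complex that is a free resolution of $Q/I$ ($H_0=Q/I$, $H_i=0$ for $i>0$). $(\mathcal{F})_i$ denotes the component of $\mathcal{F}$ in homological degree $i$. *)

(* Defs.v *)
From HB Require Import structures.
From mathcomp Require Import all_boot all_order all_algebra.
From mathcomp Require Import generic_quotient ring_quotient zify.
From mathcomp.multinomials Require Export mpoly.
From Stdlib Require Import ClassicalEpsilon.

Set Implicit Arguments.
Unset Strict Implicit.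
Unset Printing Implicit Defensive.

Import GRing.Theory.

Local Open Scope ring_scope.
Local Open Scope quotient_scope.

Section Submodule.
Variables (R : pzRingType) (V : lmodType R) (S : submodClosed V).

Record submod := Submod { submod_val :> V; _ : submod_val \in S }.

HB.instance Definition _ := [isSub for submod_val].
HB.instance Definition _ := [Choice of submod by <:].
HB.instance Definition _ := [SubChoice_isSubLmodule of submod by <:].
End Submodule.

Section Modules.
Variable R : pzRingType.

Definition has_basis (M : lmodType R) (r : nat) : Prop :=
  exists b : 'I_r -> M,
    forall x, exists! c : {ffun 'I_r -> R}, x = \sum_j c j *: b j.

(* Unspecified when M has no finite basis. Over a nontrivial commutative ring
   the cardinal of a finite basis depends only on M. *)
Definition rank (M : lmodType R) : nat := epsilon (inhabits 0%N) (has_basis M).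

Record complex := Complex {
  component :> nat -> lmodType R;
  diff : forall i, {linear component i.+1 -> component i};
  diff_diff : forall i x, diff i (diff i.+1 x) = 0
}.

Section Subcomplex.
Variables (C : complex) (P : forall i, submodClosed (C i)).
Hypothesis diffP : forall i x, x \in P i.+1 -> diff C i x \in P i.

Definition sub_diff i (x : submod (P i.+1)) : submod (P i) :=
  Submod (diffP (valP x)).

Fact sub_diff_is_linear i : linear (@sub_diff i).
Proof. by move=> a x y; apply: val_inj; rewrite /= !linearP. Qed.

HB.instance Definition _ i :=
  GRing.isLinear.Build R _ _ _ (@sub_diff i) (@sub_diff_is_linear i).

Fact sub_diff_diff i (x : submod (P i.+2)) : sub_diff (sub_diff x) = 0.
Proof. by apply: val_inj; rewrite /= diff_diff. Qed.

Definition subcomplex : complex :=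
  @Complex (fun i => submod (P i)) (fun i => @sub_diff i) sub_diff_diff.
End Subcomplex.
End Modules.

(* Q / I is {ideal_quot I}, on which a : Q acts as multiplication by \pi a.
   The condition H_0(F) = Q / I says that some surjective Q-linear map
   F_0 -> Q / I has the image of F_1 -> F_0 as its kernel. *)
Definition free_resolution (Q : comNzRingType) (I : idealr Q)
    (F : complex Q) : Prop :=
  [/\ forall i, exists r, has_basis (F i) r,
      forall i (x : F i.+1),
        diff F i x = 0 <-> exists y, x = diff F i.+1 y
    & exists e : F 0 -> {ideal_quot I},
      [/\ forall a x y, e (a *: x + y) = \pi_{ideal_quot I} a * e x + e y,
          forall z, exists x, e x = z
        & forall x, e x = 0 <-> exists y, x = diff F 0 y]].

Section MonomialIdeal.
Variables (k : fieldType) (n q : nat).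
Local Notation Q := {mpoly k[n]}.
Variable m : 'I_q -> 'X_{1..n}.

Definition generate (A : {set 'I_q}) (I : {pred Q}) : Prop :=
  forall p, p \in I <-> exists c : 'I_q -> Q, p = \sum_(i in A) c i * 'X_[m i].

Definition minimal_monomial_generators (I : {pred Q}) : Prop :=
  generate setT I /\
    forall A : {set 'I_q}, A \proper setT -> ~ generate A I.

Definition lcm_set (A : {set 'I_q}) : 'X_{1..n} :=
  \big[@mlcm n/0%MM]_(i in A) m i.

Definition scarf_witness (t : nat) : bool :=
  [exists A : {set 'I_q}, exists B : {set 'I_q},
     [&& A != B, #|A| == t & lcm_set A == lcm_set B]].

(* The infimum of the t such that scarf_witness t, with None for infinity;
   such a t is the cardinal of a subset of 'I_q, hence is at most q. *)
Definition scarf_number : option nat :=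
  ohead [seq t <- iota 0 q.+1 | scarf_witness t].

Lemma scarf_numberP :
  if scarf_number is Some l
  then scarf_witness l /\ forall t, scarf_witness t -> (l <= t)%N
  else forall t, ~~ scarf_witness t.
Proof.
have in_s t : scarf_witness t -> t \in [seq t <- iota 0 q.+1 | scarf_witness t].
  move=> wt; rewrite mem_filter wt mem_iota /= add0n ltnS.
  have /existsP[A /existsP[B /and3P[_ /eqP <- _]]] := wt.
  by rewrite -[leqRHS]card_ord max_card.
have: sorted ltn [seq t <- iota 0 q.+1 | scarf_witness t].
  by rewrite sorted_filter ?iota_ltn_sorted //; apply: ltn_trans.
have: all scarf_witness [seq t <- iota 0 q.+1 | scarf_witness t].
  exact: filter_all.
rewrite /scarf_number; case: filter in_s => [|l s] in_s /=.
  by move=> _ _ t; apply/negP => /in_s.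
move=> /andP[wl _]; rewrite (path_sortedE ltn_trans) => /andP[/allP lt_l _].
split=> // t /in_s; rewrite inE => /predU1P[-> //|/lt_l]; exact: ltnW.
Qed.

Local Notation face i := {A : {set 'I_q} | #|A| == i}.

Definition taylor_mod (i : nat) : lmodType Q := {ffun face i -> Q^o}.

(* The basis element indexed by A when #|A| = i, and 0 otherwise. *)
Definition taylor_eps i (A : {set 'I_q}) : taylor_mod i :=
  [ffun s => (val s == A)%:R].

(* The truncated subtraction of exponents is exact here, see lcm_setS. *)
Definition taylor_coef (A : {set 'I_q}) (j : 'I_q) : Q :=
  (-1) ^+ #|[set h in A | (h < j)%N]|
    * 'X_[(lcm_set A - lcm_set (A :\ j))%MM].

Definition taylor_bd i (A : {set 'I_q}) : taylor_mod i :=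
  \sum_(j in A) taylor_coef A j *: taylor_eps i (A :\ j).

Definition taylor_diff i (x : taylor_mod i.+1) : taylor_mod i :=
  \sum_s (x s : Q) *: taylor_bd i (val s).

Fact taylor_diff_is_linear i : linear (@taylor_diff i).
Proof.
move=> a x y; rewrite /taylor_diff scaler_sumr -big_split /=.
by apply: eq_bigr => s _; rewrite !ffunE scalerDl scalerA.
Qed.

HB.instance Definition _ i := GRing.isLinear.Build Q _ _ _ (@taylor_diff i)
  (@taylor_diff_is_linear i).

Lemma taylor_diff_eps i (A : {set 'I_q}) : #|A| = i.+1 ->
  taylor_diff (taylor_eps i.+1 A) = taylor_bd i A.
Proof.
move=> cA; have cA' : #|A| == i.+1 by apply/eqP.
rewrite /taylor_diff (bigD1 (exist _ A cA')) //= ffunE eqxx scale1r.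
rewrite big1 ?addr0 // => s; rewrite -val_eqE /= => /negPf sA.
by rewrite ffunE sA scale0r.
Qed.

Lemma lcm_setS (A B : {set 'I_q}) : A \subset B -> (lcm_set A <= lcm_set B)%MM.
Proof.
have lcmE C h : lcm_set C h = \max_(i in C) m i h.
  rewrite /lcm_set.
  apply: (big_morph (fun u : 'X_{1..n} => u h)) => [u v|]; rewrite mnmE //.
move=> sAB; apply/mnm_lepP => h; rewrite !lcmE; apply/bigmax_leqP => i iA.
exact: (@leq_bigmax_cond _ (mem B) (fun j => m j h)) (subsetP sAB i iA).
Qed.

Lemma taylor_diff_diff i (x : taylor_mod i.+2) :
  taylor_diff (taylor_diff x) = 0.
Proof.
rewrite [taylor_diff x]/taylor_diff linear_sum big1 // => -[A /= cA] _.
rewrite linearZ /=; suff -> : taylor_diff (taylor_bd i.+1 A) = 0.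
  by rewrite scaler0.
pose G (j h : 'I_q) : taylor_mod i := (taylor_coef A j * taylor_coef (A :\ j) h)
  *: taylor_eps i (A :\ j :\ h).
have GC (j h : 'I_q) : j \in A -> h \in A -> (j < h)%N -> G h j = - G j h.
  move=> jA hA jh; rewrite /G -scaleNr.
  have -> : A :\ h :\ j = A :\ j :\ h by rewrite !setDDl setUC.
  congr (_ *: _); rewrite /taylor_coef.
  have -> : A :\ h :\ j = A :\ j :\ h by rewrite !setDDl setUC.
  have -> : [set l in A :\ h | (l < j)%N] = [set l in A | (l < j)%N].
    apply/setP => l; rewrite !inE; case: (ltnP l j) => lj; rewrite ?andbF //.
    by rewrite !andbT; case: eqP => // lh; move: jh; rewrite -lh ltnNge ltnW.
  have -> : #|[set l in A | (l < h)%N]| = #|[set l in A :\ j | (l < h)%N]|.+1.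
    rewrite (cardsD1 j) !inE jA jh add1n; congr _.+1.
    by apply: eq_card => l; rewrite !inE andbA.
  rewrite exprS -!mulrA mulN1r; congr (- _).
  have E (a b u v u' v' : Q) : u * v = u' * v' ->
    a * (u * (b * v)) = b * (u' * (a * v')).
    by move=> e; rewrite (mulrCA u) (mulrCA u') e [LHS]mulrCA.
  apply: E; rewrite -!mpolyXD; congr 'X_[_].
  have s1 l : (lcm_set (A :\ l) <= lcm_set A)%MM by rewrite lcm_setS ?subD1set.
  have s2 : (lcm_set (A :\ j :\ h) <= lcm_set (A :\ j))%MM.
    by rewrite lcm_setS ?subD1set.
  have s3 : (lcm_set (A :\ j :\ h) <= lcm_set (A :\ h))%MM.
    by rewrite lcm_setS // !setDDl setUC -setDDl subD1set.
  apply/mnmP => l; rewrite !(mnmDE, mnmBE).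
  move: (s1 j) (s1 h) s2 s3 => /mnm_lepP/(_ l) + /mnm_lepP/(_ l) + /mnm_lepP/(_ l) + /mnm_lepP/(_ l).
  by move=> *; rewrite !addnBA // !subnK.
have -> : taylor_diff (taylor_bd i.+1 A) =
    \sum_(j in A) \sum_(h in A :\ j) G j h.
  rewrite linear_sum; apply: eq_bigr => j jA /=.
  rewrite linearZ /= taylor_diff_eps; last first.
    by apply: succn_inj; rewrite -(eqP cA) (cardsD1 j A) jA.
  by rewrite scaler_sumr; apply: eq_bigr => h _; rewrite scalerA.
have -> : \sum_(j in A) \sum_(h in A :\ j) G j h =
    \sum_(j in A) (\sum_(h in A | (j < h)%N) G j h
                   + \sum_(h in A | (h < j)%N) G j h).
  apply: eq_bigr => j jA; rewrite (bigID (fun h : 'I_q => (j < h)%N)) /=.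
  congr (_ + _); apply: eq_bigl => h; rewrite !inE -?leqNgt; case: (h \in A);
    rewrite ?andbF ?andbT //= -val_eqE /=; lia.
rewrite big_split /= [X in _ + X](exchange_big_dep (mem A)) /=; last first.
  by move=> j h _ /andP[].
rewrite -big_split big1 //= => j jA.
rewrite [X in _ + X](eq_bigl (fun h : 'I_q => (h \in A) && (j < h)%N)).
  rewrite -big_split big1 //= => h /andP[hA jh].
  by rewrite (GC j h) // addrN.
by move=> h; rewrite jA.
Qed.

Definition taylor : complex Q :=
  @Complex Q taylor_mod (fun i => @taylor_diff i) taylor_diff_diff.

(* Vanishing of the coordinates at the A containing S: the span of the other
   basis elements. *)
Definition pivot_pred (S : {set 'I_q}) i : {pred taylor_mod i} :=
  [pred x : taylor_mod i | [forall s : face i, (S \subset val s) ==> (x s == 0)]].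

Fact pivot_pred_closed S i : submod_closed (@pivot_pred S i).
Proof.
split=> [|a x y /forallP Px /forallP Py]; apply/forallP => s; apply/implyP => Ss.
  by rewrite ffunE.
have /eqP x0 := implyP (Px s) Ss; have /eqP y0 := implyP (Py s) Ss.
by rewrite !ffunE x0 y0 scaler0 addr0.
Qed.

HB.instance Definition _ S i :=
  GRing.isSubmodClosed.Build Q (taylor_mod i) (@pivot_pred S i)
    (@pivot_pred_closed S i).

Fact taylor_diff_pivot S i (x : taylor i.+1) :
  x \in @pivot_pred S i.+1 -> diff taylor i x \in @pivot_pred S i.
Proof.
move=> /forallP Px; apply: rpred_sum => s _.
have [Ss|nSs] := boolP (S \subset val s).
  by have /eqP-> := implyP (Px s) Ss; rewrite scale0r rpred0.
apply: rpredZ; apply: rpred_sum => j _; apply: rpredZ.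
apply/forallP => t; apply/implyP => St; rewrite ffunE.
case: (val t =P _) => // tE; case/negP: nSs; apply: subset_trans St _.
by rewrite tE subD1set.
Qed.

Definition pivot l (i_ : 'I_l -> 'I_q) : complex Q :=
  subcomplex (@taylor_diff_pivot [set i_ j | j : 'I_l]).

Inductive pivot_complex : complex Q -> Prop :=
| PivotTaylor : pivot_complex taylor
| PivotSub l (i_ : 'I_l -> 'I_q) :
    (2 <= l)%N -> {homo i_ : a b / (a < b)%N} -> pivot_complex (pivot i_).

Definition pivot_resolution (I : idealr Q) (F : complex Q) : Prop :=
  pivot_complex F /\ free_resolution I F.
End MonomialIdeal.

(* The convention that a binomial coefficient with negative lower index is 0. *)
Definition binz (a : nat) (b : int) : nat :=
  if b is Posz b' then 'C(a, b') else 0.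

(* Main.v *)
(* Multidegree by multidegree, the Taylor complex is the chain complex of a
   simplex. A nonempty simplex is a cone over each of its vertices. If [m j0]
   divides the lcm of the [m i], [i \in S], for some [j0] outside [S], the cone
   over [j0], used in the multidegrees divisible by [m j0], also contracts the
   strands of the pivot complex of [S]. Conversely, if the pivot complex of [S]
   is exact, then the basis element of [S], corrected by an element of the pivot
   complex with the same boundary, is a Taylor boundary; its coefficient 1 at
   [S] forces such a [j0] to exist. A set [S] with such a [j0] is a Scarf
   witness, and every witness of minimal size has such a [j0]. *)
From HB Require Import structures.
From mathcomp Require Import all_boot all_order all_algebra.
From mathcomp Require Import generic_quotient ring_quotient zify ring.
From Stdlib Require Import ClassicalEpsilon.
Require Import Defs.
Import GRing.Theory.
Local Open Scope ring_scope.
Local Open Scope quotient_scope.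

Set Implicit Arguments.
Unset Strict Implicit.
Unset Printing Implicit Defensive.

(** * Ranks of modules with a finite basis *)

Section Rank.
Variable R : comNzRingType.
Implicit Type M : lmodType R.

(** Writing each basis in the other gives two matrices. Uniqueness of coordinates makes their
    product the identity, which over a nonzero commutative ring bounds the outer size by the inner
    one. *)
Lemma has_basis_leq M r r' : has_basis M r -> has_basis M r' -> (r <= r')%N.
Proof.
move=> [b bP] [b' b'P].
have [A AP] := fin_all_exists (fun j => let: ex_intro c P := b'P (b j) in
  ex_intro (fun c : {ffun _ -> R} => b j = \sum_t c t *: b' t) c P.1).
have [B BP] := fin_all_exists (fun j => let: ex_intro c P := bP (b' j) in
  ex_intro (fun c : {ffun _ -> R} => b' j = \sum_t c t *: b t) c P.1).
apply: (@mulmx1_min R r r' (\matrix_(i, j) A i j) (\matrix_(i, j) B i j)).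
apply/matrixP => i j; rewrite !mxE.
have [c [_ cU]] := bP (b i).
have c1 : c = [ffun j => (i == j)%:R].
  apply: cU; rewrite (bigD1 i) //= ffunE eqxx scale1r big1 ?addr0 // => t.
  by rewrite ffunE eq_sym => /negPf->; rewrite scale0r.
have c2 : c = [ffun j => \sum_t A i t * B t j].
  apply: cU; rewrite {1}(AP i).
  under eq_bigr => t _ do rewrite (BP t) scaler_sumr.
  rewrite exchange_big; apply: eq_bigr => h _ /=.
  by rewrite ffunE scaler_suml; apply: eq_bigr => t _; rewrite scalerA.
move: c2; rewrite c1 => /ffunP/(_ j); rewrite !ffunE => ->.
by apply: eq_bigr => t _; rewrite !mxE.
Qed.

Lemma rank_basis M r : has_basis M r -> rank M = r.
Proof.
move=> br; have br' : has_basis M (rank M) by apply: epsilon_spec; exists r.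
by apply/eqP; rewrite eqn_leq (has_basis_leq br' br) (has_basis_leq br br').
Qed.

Lemma has_basis_ffun M (J : finType) (f : {linear M -> {ffun J -> R^o}}) :
  bijective f -> has_basis M #|J|.
Proof.
case=> g fK gK; exists (fun j => g [ffun s => (s == enum_val j)%:R]).
have E (c : {ffun 'I_#|J| -> R}) s :
    f (\sum_j c j *: g [ffun s => (s == enum_val j)%:R]) s = c (enum_rank s).
  rewrite linear_sum sum_ffunE (bigD1 (enum_rank s)) //= linearZ /= gK.
  rewrite !ffunE enum_rankK eqxx [_ *: _]mulr1 big1 ?addr0 // => j jN.
  rewrite linearZ /= gK !ffunE; case: eqP => [sE|_]; last exact: mulr0.
  by rewrite sE enum_valK eqxx in jN.
move=> x; exists [ffun j => f x (enum_val j)]; split.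
  apply: (can_inj fK); apply/ffunP => s.
  by rewrite E ffunE enum_rankK.
move=> c xE; apply/ffunP => j; rewrite ffunE xE.
by rewrite E enum_valK.
Qed.
End Rank.

(** * Extension by zero and sign exponents *)

Section Extension.
Variables (T : choiceType) (P : pred T) (R : nmodType).

(** Chains are functions on the faces of a fixed size; extending them by zero allows evaluation at
    any set without a proof of its size. *)
Definition ext (x : {t | P t} -> R) (t : T) : R := oapp x 0 (insub t).

Lemma ext_val x s : ext x (val s) = x s.
Proof. by rewrite /ext valK. Qed.

Lemma extE x t (Pt : P t) : ext x t = x (exist _ t Pt).
Proof. by rewrite /ext insubT. Qed.

Lemma ext_out x t : ~~ P t -> ext x t = 0.
Proof. by move=> /negPf Pt; rewrite /ext insubF. Qed.
End Extension.

Section Sign.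
Variables (q : nat).
Implicit Type A : {set 'I_q}.

(** The sign exponent of the Taylor differential. It is unaffected by adjoining [j], so it can be
    read on a face or on its facet. *)
Definition below (j : 'I_q) A := #|[set h in A | (h < j)%N]|.

Lemma below1U j h A : h \notin A -> below j (h |: A) = ((h < j) + below j A)%N.
Proof.
move=> hA; rewrite /below (cardsD1 h) !inE eqxx /=; congr (_ + _)%N.
apply: eq_card => t; rewrite !inE; case: eqP => //= ->.
by rewrite (negPf hA).
Qed.

Lemma below_id j A : below j (j |: A) = below j A.
Proof.
by apply: eq_card => t; rewrite !inE; case: eqP => //= ->; rewrite ltnn !andbF.
Qed.
End Sign.

Lemma increasing_enum q l (S : {set 'I_q}) : #|S| = l ->
  exists2 f : 'I_l -> 'I_q, {homo f : a b / (a < b)%N} &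
    [set f j | j : 'I_l] = S.
Proof.
move=> cS; exists (fun j => enum_val (cast_ord (esym cS) j)).
  move=> a b ab; pose x0 := enum_val (cast_ord (esym cS) a).
  rewrite !(enum_val_nth x0) /= -!(nth_map x0 (val x0)) -?cardE ?cS //.
  apply: (sorted_ltn_nth ltn_trans) => //; last 2 first.
  - by rewrite inE size_map -cardE cS.
  - by rewrite inE size_map -cardE cS.
  rewrite /enum_mem -enumT sorted_map sorted_filter //.
    by move=> x y z; apply: ltn_trans.
  by rewrite -sorted_map val_enum_ord iota_ltn_sorted.
apply/setP => x; apply/imsetP/idP => [[j _ ->]|xS]; first exact: enum_valP.
exists (cast_ord cS (enum_rank_in xS x)) => //.
by rewrite cast_ordK enum_rankK_in.
Qed.

Lemma card_increasing_image q l (f : 'I_l -> 'I_q) :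
  {homo f : a b / (a < b)%N} -> #|[set f j | j : 'I_l]| = l.
Proof.
move=> f_homo; rewrite card_imset ?card_ord // => a b fab.
apply/eqP; rewrite -val_eqE /=.
by case: ltngtP => // /f_homo; rewrite fab ltnn.
Qed.

(** * Divisibility of lcms and multigraded strands of the Taylor complex *)

Section Taylor.
Variables (k : fieldType) (n q : nat) (m : 'I_q -> 'X_{1..n}).
Local Notation Q := {mpoly k[n]}.
Implicit Types (A B S : {set 'I_q}) (u : 'X_{1..n}).

Lemma lcm_set_le A u :
  reflect (forall j, j \in A -> m j <= u)%MM (lcm_set m A <= u)%MM.
Proof.
have -> : (lcm_set m A <= u)%MM = [forall (j | j \in A), (m j <= u)%MM].
  rewrite -big_andE /lcm_set.
  apply: (big_morph (fun v => v <= u)%MM) => [v w|]; first exact: lem_mlcm.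
  by apply/mnm_lepP => h; rewrite mnm0E.
exact: forall_inP.
Qed.

Lemma le_lcm_set A j : j \in A -> (m j <= lcm_set m A)%MM.
Proof. by move: j; apply/lcm_set_le/lepm_refl. Qed.

Lemma lcm_setU1_le A j u :
  (lcm_set m (j |: A) <= u)%MM = (m j <= u)%MM && (lcm_set m A <= u)%MM.
Proof.
apply/lcm_set_le/andP => [le_u|[ju /lcm_set_le Au] h].
  split; first by rewrite le_u ?setU11.
  by apply/lcm_set_le => h hA; rewrite le_u // inE hA orbT.
by rewrite !inE => /predU1P[->|/Au].
Qed.

(* The multidegree [u] component of [x], on the basis of the monomial multiples
   of the [taylor_eps i A]. *)
Definition strand i (x : taylor_mod k n q i) u A : k :=
  if (lcm_set m A <= u)%MM then (ext x A)@_(u - lcm_set m A) else 0.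

(** The coefficient at exponent [a] on the face [A] is visible in multidegree [a + lcm_set m A], so
    the strands lose nothing. *)
Lemma strand_inj i (x y : taylor_mod k n q i) :
  (forall u A, #|A| = i -> strand x u A = strand y u A) -> x = y.
Proof.
move=> xy; apply/ffunP => s; apply/mpolyP => a.
have := xy (a + lcm_set m (val s))%MM (val s) (eqP (valP s)).
by rewrite /strand lem_addl !ext_val addmK.
Qed.

Lemma strandB i (x y : taylor_mod k n q i) u A :
  strand (x - y) u A = strand x u A - strand y u A.
Proof.
rewrite /strand; case: ifP => _; last by rewrite subr0.
rewrite -mcoeffB /ext; case: insubP => [s _ _|_] /=; first by rewrite !ffunE.
by rewrite subr0.
Qed.

(** The transposed form of the differential: its definition spreads a face over its facets, while
    the coefficient at [A] collects the contributions of the cofaces [j |: A]. *)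
Lemma ext_taylor_diff i (x : taylor_mod k n q i.+1) A : #|A| = i ->
  ext (taylor_diff m x) A =
  \sum_(j | j \notin A) ext x (j |: A) * taylor_coef k m (j |: A) j.
Proof.
move=> cA; have cA' : #|A| == i by apply/eqP.
rewrite (@extE _ (fun B : {set 'I_q} => #|B| == i) _ _ A cA').
rewrite /taylor_diff sum_ffunE.
under eq_bigr => s _ do rewrite ffunE sum_ffunE scaler_sumr.
rewrite (exchange_big_dep xpredT) //= [RHS]big_mkcond.
apply: eq_bigr => j _; case: ifPn => jA; last first.
  apply: big1 => s js; rewrite !ffunE /=; case: eqP => [AE|_].
    by move: jA; rewrite AE !inE eqxx.
  by rewrite /GRing.scale /= !mulr0.
have cj : #|j |: A| == i.+1 by rewrite cardsU1 jA cA.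
rewrite (bigD1 (exist _ (j |: A) cj)) /= ?setU11 //.
rewrite (@extE _ (fun B : {set 'I_q} => #|B| == i.+1) _ _ (j |: A) cj).
rewrite big1 ?addr0 => [|s /andP[js sN]].
  rewrite !ffunE /= setU1K //.
  by rewrite eqxx [taylor_coef _ _ _ _ *: _]mulr1.
rewrite !ffunE /=; case: eqP => [AE|]; last by rewrite /GRing.scale /= !mulr0.
by case/eqP: sN; apply: val_inj; rewrite /= AE setD1K.
Qed.

Lemma mcoeffMX_lt (p : Q) (a u : 'X_{1..n}) :
  ~~ (a <= u)%MM -> (p * 'X_[a])@_u = 0.
Proof.
move=> au; apply: memN_msupp_eq0; rewrite (perm_mem (msuppMX _ _)).
by apply/mapP => -[b _ uE]; rewrite uE lem_addr in au.
Qed.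

(** The monomial in [taylor_coef] only makes up the difference of the multidegrees of a face and its
    facet. In a fixed multidegree the sign alone remains: this is the simplicial boundary. *)
Lemma strand_diff i (x : taylor_mod k n q i.+1) u A : #|A| = i ->
  strand (taylor_diff m x) u A =
  \sum_(j | j \notin A) (-1) ^+ below j A * strand x u (j |: A).
Proof.
move=> cA; rewrite /strand ext_taylor_diff // raddf_sum /=.
case: ifPn => Au; last first.
  by rewrite big1 // => j _; rewrite lcm_setU1_le (negPf Au) andbF mulr0.
apply: eq_bigr => j jA; rewrite /taylor_coef.
rewrite -[#|_|]/(below j _) below_id setU1K // mulrCA.
have E : ((ext x (j |: A) : Q) * 'X_[(lcm_set m (j |: A) - lcm_set m A)])
    @_(u - lcm_set m A) =
    if (lcm_set m (j |: A) <= u)%MM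
    then (ext x (j |: A))@_(u - lcm_set m (j |: A)) else 0.
  have AjA : (lcm_set m A <= lcm_set m (j |: A))%MM.
    by rewrite lcm_setS ?subsetUr.
  case: ifPn => ju.
    rewrite -[in RHS](mcoeffMX _ (lcm_set m (j |: A) - lcm_set m A)).
    congr (_@_ _); apply/mnmP => h; rewrite !(mnmDE, mnmBE).
    by move/mnm_lepP/(_ h): AjA; move/mnm_lepP/(_ h): ju; lia.
  (* If [lcm_set m (j |: A)] does not divide [u], the shifting monomial does not divide
     [u - lcm_set m A], so the coefficient vanishes, in agreement with the default 0. *)
  apply: mcoeffMX_lt; apply: contra ju => /mnm_lepP le_u.
  apply/mnm_lepP => h; move/(_ h): le_u; rewrite !mnmBE.
  by move/mnm_lepP/(_ h): Au; lia.
rewrite -signr_odd -[in RHS]signr_odd !mulr_sign.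
by case: odd; rewrite ?mcoeffN; [congr (- _)|]; exact: E.
Qed.

(** * Contraction of strands by cones *)

Section Exactness.
(* The strand of multidegree [u] is the chain complex of the simplex on the
   [j] with [m j <= u]; [c u] is the apex of a cone contracting it. *)
Variable c : 'X_{1..n} -> option 'I_q.
Hypothesis c_some : forall u j, c u = Some j -> (m j <= u)%MM.
Hypothesis c_none : forall u, c u = None -> forall j, ~~ (m j <= u)%MM.

(** The cone homotopy sends a face [B] avoiding the apex [v] to [v |: B] up to sign; this is its
    coefficient at [A], where [B] is [A :\ v]. *)
Definition cone_coef i (x : taylor_mod k n q i) u A : k :=
  if c u is Some v then
    if v \in A then (-1) ^+ below v (A :\ v) * strand x u (A :\ v) else 0
  else 0.

(** Prescribed strands come from polynomials when they vanish in large degree and wherever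
    [lcm_set m A] does not divide [u]. The first holds because [x] has bounded degree, the second by
    [c_some]. *)
Lemma cone_exists i (x : taylor_mod k n q i) :
  exists y : taylor_mod k n q i.+1,
    forall u A, #|A| = i.+1 -> strand y u A = cone_coef x u A.
Proof.
pose d := (\sum_s msize (x s : Q))%N.
have xd A a : (d <= mdeg a)%N -> (ext x A)@_a = 0.
  move=> da; rewrite /ext; case: insubP => [s _ _|_] /=; last exact: mcoeff0.
  apply: memN_msupp_eq0; apply: msize_mdeg_ge; apply: leq_trans da.
  by rewrite /d (bigD1 s) //= leq_addr.
exists [ffun s => \sum_(a : 'X_{1..n < d})
  cone_coef x (a + lcm_set m (val s)) (val s) *: 'X_[a]] => u A cA.
have cA' : #|A| == i.+1 by apply/eqP.
rewrite {1}/strand (@extE _ (fun B : {set 'I_q} => #|B| == i.+1) _ _ A cA').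
rewrite ffunE /=; case: ifPn => Au.
  have [dlt|dge] := ltnP (mdeg (u - lcm_set m A)%MM) d.
    by rewrite (mcoeff_mpoly (fun a => cone_coef x (a + lcm_set m A) A)) ?submK.
  rewrite raddf_sum /= big1 => [|a _]; last first.
    rewrite mcoeffZ mcoeffX; case: eqP => [E|_]; last exact: mulr0.
    by move: dge; rewrite -E leqNgt bmdeg.
  (* Removing [v] can only shrink the lcm, so the exponent at which [x] is read also has degree at
     least [d]. *)
  rewrite /cone_coef; case: (c u) => // v; case: ifPn => // vA.
  rewrite /strand; case: ifP => _; rewrite ?xd ?mulr0 //.
  apply: leq_trans dge _; rewrite !mdegE; apply: leq_sum => h _.
  rewrite !mnmBE; apply: leq_sub2l.
  by apply/mnm_lepP/lcm_setS/subD1set.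
rewrite /cone_coef; case cu: (c u) => [v|] //; case: ifPn => // vA.
rewrite /strand; case: ifPn => Avu; last by rewrite mulr0.
by rewrite -(setD1K vA) lcm_setU1_le (c_some cu) Avu in Au.
Qed.

(** The cone homotopy formula, applied to a cycle. In a multidegree without apex no generator
    divides [u], so the nonempty faces carry nothing. *)
Lemma cone_boundary i (x : taylor_mod k n q i.+1) (y : taylor_mod k n q i.+2) :
  taylor_diff m x = 0 ->
  (forall u A, #|A| = i.+2 -> strand y u A = cone_coef x u A) ->
  taylor_diff m y = x.
Proof.
move=> dx yx; apply: strand_inj => u A cA; rewrite strand_diff //.
case cu: (c u) => [v|]; last first.
  rewrite big1 => [|j jA]; last first.
    by rewrite yx ?cardsU1 ?jA ?cA // /cone_coef cu mulr0.
  rewrite /strand; case: ifP => // /lcm_set_le Au.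
  have /card_gt0P[j jA] : (0 < #|A|)%N by rewrite cA.
  by have := c_none cu j; rewrite Au.
under eq_bigr => j jA do rewrite yx ?cardsU1 ?jA ?cA // /cone_coef cu.
(* If [v] is outside [A], only the term [j = v] survives and its two signs cancel. If [v] is in [A],
   the cycle condition at [A :\ v] expresses the coefficient of [x] at [A] through the other
   cofaces. *)
have [vA|vA] := boolP (v \in A); last first.
  rewrite (bigD1 v) //= setU11 setU1K // signrMK big1 ?addr0 //.
  move=> j /andP[_ jv].
  by rewrite !inE eq_sym (negPf jv) (negPf vA) mulr0.
have cAv : #|A :\ v| = i by apply: succn_inj; rewrite -cA (cardsD1 v A) vA.
have := strand_diff x u cAv; rewrite dx.
have -> : strand (0 : taylor_mod k n q i) u (A :\ v) = 0.
  by rewrite -[0](subrr 0) strandB subrr.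
rewrite (bigD1 v) ?setD11 //= setD1K // => /esym/eqP.
rewrite addr_eq0 => /eqP E.
rewrite -[RHS](signrMK (below v (A :\ v))) E mulrN mulr_sumr -sumrN.
rewrite [RHS](eq_bigl (fun j => j \notin A)); last first.
  move=> j; rewrite !inE; case: eqP => [->|_] //=; last by rewrite andbT.
  by rewrite vA.
apply: eq_bigr => j jA; rewrite inE vA orbT.
have jv : j != v by apply: contraNneq jA => ->.
have -> : (j |: A) :\ v = j |: (A :\ v).
  by apply/setP => h; rewrite !inE; case: (h =P j) => [->|//]; rewrite jv.
have -> : below j A = ((v < j) + below j (A :\ v))%N.
  by rewrite -{1}(setD1K vA) below1U ?setD11.
rewrite below1U ?inE ?(negPf jA) ?andbF // !exprD.
(* Exactly one of the two comparisons holds: adjoining [v] and [j] in the two orders gives opposite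
   signs. *)
have : ((-1) ^+ (v < j)%N * (-1) ^+ (j < v)%N = -1 :> k).
  by move: jv; rewrite -val_eqE /=; case: ltngtP => //= _ _;
    rewrite ?mulr1 ?mul1r.
have swap (a b a' b' s : k) : a * b * (a' * b' * s) = a * a' * (b' * (b * s)).
  by ring.
by move=> sgnE; rewrite swap sgnE mulN1r.
Qed.
End Exactness.

(** For the full Taylor complex any generator dividing [u] can serve as apex. *)
Definition first_apex u : option 'I_q := [pick j | (m j <= u)%MM].

Lemma first_apex_some u j : first_apex u = Some j -> (m j <= u)%MM.
Proof. by rewrite /first_apex; case: pickP => // h hu [<-]. Qed.

Lemma first_apex_none u : first_apex u = None -> forall j, ~~ (m j <= u)%MM.
Proof. by rewrite /first_apex; case: pickP => // nu _ j; rewrite nu. Qed.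

Lemma taylor_exact i (x : taylor_mod k n q i.+1) :
  taylor_diff m x = 0 -> exists y : taylor_mod k n q i.+2, taylor_diff m y = x.
Proof.
move=> dx; have [y yP] := cone_exists first_apex_some x.
exists y.
exact (cone_boundary first_apex_none dx yP).
Qed.

(** * Exactness of pivot complexes *)

Lemma pivot_predP S i (x : taylor_mod k n q i) :
  reflect (forall A, S \subset A -> ext x A = 0) (x \in @pivot_pred k n q S i).
Proof.
apply: (iffP forallP) => [Px A SA|x0 s].
  rewrite /ext; case: insubP => [s _ sA|_] //=; apply/eqP.
  by apply: implyP (Px s) _; rewrite sA.
by apply/implyP => Ss; rewrite -(ext_val x) x0.
Qed.

Lemma strand_pivot S i (x : taylor_mod k n q i) :
  (forall u A, #|A| = i -> S \subset A -> strand x u A = 0) ->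
  x \in @pivot_pred k n q S i.
Proof.
move=> x0; apply/pivot_predP => A SA; apply/mpolyP => a; rewrite mcoeff0.
have [cA|cA] := eqVneq #|A| i; last by rewrite ext_out ?mcoeff0.
by have := x0 (a + lcm_set m A)%MM A cA SA; rewrite /strand lem_addl addmK.
Qed.

(** The contraction could leave the pivot complex only at a face containing [S] whose apex lies in
    [S]; taking [j0] as apex whenever possible excludes this. *)
Lemma pivot_exact S j0 i (x : taylor_mod k n q i.+1) :
  j0 \notin S -> (m j0 <= lcm_set m S)%MM ->
  x \in @pivot_pred k n q S i.+1 -> taylor_diff m x = 0 ->
  exists2 y : taylor_mod k n q i.+2,
    y \in @pivot_pred k n q S i.+2 & taylor_diff m y = x.
Proof.
move=> j0S j0le /pivot_predP Px dx.
pose c u := if (m j0 <= u)%MM then Some j0 else first_apex u.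
have c_some u j : c u = Some j -> (m j <= u)%MM.
  by rewrite /c; case: ifP => [ju [<-]|_ /first_apex_some].
have c_none u : c u = None -> forall j, ~~ (m j <= u)%MM.
  by rewrite /c; case: ifP => // _ /first_apex_none.
have [y yP] := cone_exists c_some x.
exists y; last exact (cone_boundary c_none dx yP).
apply: strand_pivot => u A cA SA; rewrite yP // /cone_coef.
case cu: (c u) => [v|] //; case: ifPn => // vA.
(* If [v] is outside [S], the face [A :\ v] still contains [S], and [x] vanishes there. *)
have [vS|vS] := boolP (v \in S); last first.
  rewrite /strand Px ?mcoeff0 ?if_same ?mulr0 // subsetD SA /=.
  by rewrite disjoint_sym disjoints1.
(* [m v] and [lcm_set m (A :\ v)] dividing [u] would make [m j0] divide [u],
   and the apex would be [j0], which is not in [S]. *)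
rewrite /strand; case: ifPn => Avu; last by rewrite mulr0.
have Su : (lcm_set m S <= u)%MM.
  apply: lepm_trans (lcm_setS m SA) _.
  by rewrite -(setD1K vA) lcm_setU1_le (c_some _ _ cu).
move: cu; rewrite /c (lepm_trans j0le Su) => -[j0v].
by rewrite j0v vS in j0S.
Qed.

Lemma strand_eps A : strand (taylor_eps k n #|A| A) (lcm_set m A) A = 1.
Proof.
rewrite /strand lepm_refl.
rewrite (@extE _ (fun B : {set 'I_q} => #|B| == #|A|) _ _ A (eqxx _)).
rewrite ffunE /= eqxx.
have -> : (lcm_set m A - lcm_set m A)%MM = 0%MM.
  by apply/mnmP => h; rewrite mnmBE subnn mnm0E.
by rewrite mcoeff1 eqxx.
Qed.

Lemma strand_pivot0 S i (x : taylor_mod k n q i) u A :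
  x \in @pivot_pred k n q S i -> S \subset A -> strand x u A = 0.
Proof.
by move=> /pivot_predP Px SA; rewrite /strand Px ?mcoeff0 ?if_same.
Qed.

Lemma pivot_resolution_dvd S (I : idealr Q) :
  (2 <= #|S|)%N ->
  free_resolution I (subcomplex (@taylor_diff_pivot k n q m S)) ->
  exists2 j, j \notin S & (m j <= lcm_set m S)%MM.
Proof.
move=> S2 [_ exactF _].
(* Since [S] has at least two elements, the boundary of its basis element lies in positive degree,
   where the pivot complex is exact. *)
have [i Si] : exists i, #|S| = i.+2 by exists (#|S| - 2)%N; lia.
have dP : taylor_diff m (taylor_eps k n i.+2 S) \in @pivot_pred k n q S i.+1.
  apply/pivot_predP => A SA; apply: ext_out; apply: contraTneq SA => cA.
  by apply/negP => /subset_leq_card; lia.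
have [exS _] := exactF i (Submod dP).
have [|[y Py] /(congr1 val) /= Ey] := exS.
  by apply: val_inj; exact: taylor_diff_diff.
(* The corrected basis element is a cycle, so it bounds in the Taylor complex, and the correction
   [y] has no coefficient at [S]. *)
have [z Ez] : exists z, taylor_diff m z = taylor_eps k n i.+2 S - y.
  by apply: taylor_exact; rewrite linearB /= -Ey subrr.
have yS : strand y (lcm_set m S) S = 0.
  by apply: strand_pivot0 Py _.
have epsS : strand (taylor_eps k n i.+2 S) (lcm_set m S) S = 1.
  by rewrite -Si; exact: strand_eps.
have := strand_diff z (lcm_set m S) Si.
rewrite Ez strandB epsS yS subr0 => E.
have [/exists_inP[j]|/exists_inPn nex] :=
    boolP [exists (j | j \notin S), (m j <= lcm_set m S)%MM]; first by exists j.
(* With no such [j], no coface [j |: S] occurs in multidegree [lcm_set m S], and the coefficient 1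
   at [S] would be a sum of zeros. *)
case/eqP: (oner_neq0 k).
rewrite E; apply: big1 => j jS.
rewrite /strand lcm_setU1_le (negPf (nex j jS)).
exact: mulr0.
Qed.

(** This computes [H_0]: the only face of size 0 is [set0], and the basis element at [[set j]] has
    boundary ['X_[m j]] there. *)
Lemma taylor_augmentation (I : {pred Q}) (x : taylor_mod k n q 0) :
  generate m setT I ->
  (ext x set0 \in I) <-> exists y : taylor_mod k n q 1, x = taylor_diff m y.
Proof.
have set10 j : j |: set0 = [set j] :> {set 'I_q} by rewrite setU0.
have dE (y : taylor_mod k n q 1) :
    ext (taylor_diff m y) set0 = \sum_j (ext y [set j] : Q) * 'X_[m j].
  rewrite ext_taylor_diff ?cards0 //; apply: eq_big => [j|j _].
    by rewrite inE.
  rewrite set10 /taylor_coef -[#|_|]/(below j _) -set10 below_id.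
  have -> : below j set0 = 0%N by apply: eq_card0 => h; rewrite !inE.
  by rewrite expr0 mul1r setDv set10 /lcm_set big_set1E mlcm0 big_set0 subm0.
move=> genI; split=> [/genI[c xE]|[y ->]].
  exists ([ffun s : {A : {set 'I_q} | #|A| == 1%N} =>
    (\sum_(j in val s) c j : Q^o)] : taylor_mod k n q 1).
  apply/ffunP => s; have s0 : val s = set0.
    by apply/eqP; rewrite -cards_eq0 (valP s).
  rewrite -[LHS](ext_val x) -[RHS](ext_val (taylor_diff m _)) s0 dE xE.
  apply: eq_big => [j|j _]; first by rewrite inE.
  rewrite (@extE _ (fun B : {set 'I_q} => #|B| == 1%N) _ _ [set j]);
    rewrite ?cards1 // => cj.
  by rewrite ffunE /= big_set1.
apply/genI; exists (fun j => ext y [set j]); rewrite dE.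
by apply: eq_bigl => j; rewrite inE.
Qed.

(** * Bases of the components, and pivot complexes as free resolutions *)

Lemma taylor_basis i : has_basis (taylor k m i) 'C(q, i).
Proof.
suff -> : 'C(q, i) = #|{: {A : {set 'I_q} | #|A| == i}}|.
  exact: (@has_basis_ffun _ _ _ idfun (Bijective (frefl _) (frefl _))).
rewrite card_sig -[q in LHS]card_ord -card_draws.
by apply: eq_card => A; rewrite !inE.
Qed.

Section PivotBasis.
Variables (S : {set 'I_q}) (i : nat).
Local Notation pivot_face := {A : {set 'I_q} | (#|A| == i) && ~~ (S \subset A)}.

Definition pivot_coord (x : subcomplex (@taylor_diff_pivot k n q m S) i) :
  {ffun pivot_face -> Q^o} := [ffun s => ext (submod_val x) (val s)].

Fact pivot_coord_is_linear : linear pivot_coord.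
Proof.
move=> a x y; apply/ffunP => s; rewrite !ffunE /ext.
case: insubP => [t _ _|_] /=; first by rewrite !ffunE.
by rewrite scaler0 addr0.
Qed.

HB.instance Definition _ := GRing.isLinear.Build Q _ _ _ pivot_coord
  pivot_coord_is_linear.

Fact pivot_of_coord_subproof (c : {ffun pivot_face -> Q^o}) :
  ([ffun s => (ext c (val s) : Q^o)] : taylor_mod k n q i)
    \in @pivot_pred k n q S i.
Proof.
apply/forallP => s; apply/implyP => Ss.
by rewrite ffunE ext_out // Ss andbF.
Qed.

Definition pivot_of_coord c : subcomplex (@taylor_diff_pivot k n q m S) i :=
  Submod (pivot_of_coord_subproof c).

Lemma pivot_coord_bij : bijective pivot_coord.
Proof.
exists pivot_of_coord => [[x Px]|c]; last first.
  apply/ffunP => s; rewrite ffunE /=.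
  have cs : #|val s| == i by case/andP: (valP s).
  rewrite (@extE _ (fun A : {set 'I_q} => #|A| == i) _ _ _ cs) ffunE /=.
  exact: ext_val.
apply: val_inj; apply/ffunP => s; rewrite ffunE /=.
have [Ss|Ss] := boolP (S \subset val s).
  by rewrite ext_out ?Ss ?andbF //; rewrite -(ext_val x) (pivot_predP _ _ Px).
have cs : (#|val s| == i) && ~~ (S \subset val s) by rewrite (valP s).
rewrite (@extE _ (fun A => (#|A| == i) && ~~ (S \subset A)) _ _ _ cs) ffunE /=.
exact: ext_val.
Qed.
End PivotBasis.

Lemma pivot_basis S i :
  has_basis (subcomplex (@taylor_diff_pivot k n q m S) i)
    #|[set A : {set 'I_q} | (#|A| == i) && ~~ (S \subset A)]|.
Proof.
have := has_basis_ffun (pivot_coord_bij S i); rewrite card_sig.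
by congr has_basis; apply: eq_card => A; rewrite !inE.
Qed.

Lemma ext_linear i (a : Q) (x y : taylor_mod k n q i) A :
  ext (a *: x + y) A = a * (ext x A : Q) + (ext y A : Q).
Proof.
rewrite /ext; case: insubP => [t _ _|_] /=; first by rewrite !ffunE.
by rewrite mulr0 addr0.
Qed.

Lemma pi_ideal_eq0 (I : idealr Q) (p : Q) :
  \pi_({ideal_quot I}) p = 0 <-> p \in (I : {pred Q}).
Proof.
rewrite -[p in p \in _]subr0 Quotient.idealrBE.
rewrite -[0 in X in X <-> _](rmorph0 \pi_({ideal_quot I})).
by split=> [->|/eqP].
Qed.

Lemma pivot_free_resolution S j0 (I : idealr Q) :
  generate m setT I -> (2 <= #|S|)%N ->
  j0 \notin S -> (m j0 <= lcm_set m S)%MM ->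
  free_resolution I (subcomplex (@taylor_diff_pivot k n q m S)).
Proof.
move=> genI S2 j0S j0le; split.
- by move=> i; eexists; exact: pivot_basis.
- move=> i [x Px]; split=> [/(congr1 val) /= dx|[y ->]]; last exact: diff_diff.
  have [y Py yx] := pivot_exact j0S j0le Px dx.
  by exists (Submod Py); apply: val_inj.
(* As [S] has at least two elements, the pivot complex agrees with the Taylor complex in degrees 0
   and 1, hence has the same [H_0]. *)
have low i (x : taylor_mod k n q i) : (i < 2)%N -> x \in @pivot_pred k n q S i.
  move=> i2; apply/pivot_predP => A SA; apply: ext_out; apply/negP => /eqP cA.
  by have := subset_leq_card SA; lia.
exists (fun x : subcomplex (@taylor_diff_pivot k n q m S) 0 =>
  \pi_({ideal_quot I}) (ext (submod_val x : taylor_mod k n q 0) set0 : Q)).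
split.
- by move=> a x y; rewrite /= ext_linear rmorphD rmorphM.
- move=> z; pose x : taylor_mod k n q 0 := [ffun=> repr z : Q^o].
  exists (Submod (low 0 x isT)).
  rewrite /= (@extE _ (fun A : {set 'I_q} => #|A| == 0) _ _ set0);
    rewrite ?cards0 // => c0.
  by rewrite ffunE reprK.
move=> x /=; rewrite pi_ideal_eq0.
split=> [/(taylor_augmentation _ genI)[y xy]|[y ->]].
  by exists (Submod (low 1%N y isT)); apply: val_inj.
by apply/(taylor_augmentation _ genI); exists (submod_val y).
Qed.

(** * Rank formulas and their comparison *)

Lemma card_superset_faces S i : (i <= q)%N ->
  #|[set A : {set 'I_q} | (#|A| == i) && (S \subset A)]| = 'C(q - #|S|, q - i).
Proof.
have -> : (q - #|S|)%N = #|~: S| by rewrite [RHS]cardsCs setCK card_ord.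
move=> iq; rewrite -cards_draws.
(* Complementation matches the sets of size [i] containing [S] with the subsets of size [q - i] of
   the complement of [S]. *)
rewrite -(card_imset _ (inv_inj (@setCK _))); apply: eq_card => A.
apply/imsetP/idP => [[B]|]; rewrite !inE => /andP[].
  by move=> /eqP cB SB ->; rewrite setCS SB cardsCs setCK cB card_ord eqxx.
move=> AS /eqP cA; exists (~: A); rewrite ?setCK // !inE -setCS setCK AS andbT.
rewrite cardsCs setCK cA card_ord; apply/eqP; lia.
Qed.

Lemma rank_taylor i : rank (taylor k m i) = 'C(q, i).
Proof. exact: rank_basis (taylor_basis i). Qed.

(** The faces of size [i] split into those that contain [S] and those that index the basis of the
    pivot complex. The additive form avoids truncated subtraction. *)
Lemma rank_pivot S i :
  (rank (subcomplex (@taylor_diff_pivot k n q m S) i)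
   + binz (q - #|S|) (i%:Z - #|S|%:Z) = 'C(q, i))%N.
Proof.
rewrite (rank_basis (pivot_basis S i)).
have Sq : (#|S| <= q)%N by rewrite -[leqRHS]card_ord max_card.
have -> : binz (q - #|S|) (i%:Z - #|S|%:Z) =
  #|[set A : {set 'I_q} | (#|A| == i) && (S \subset A)]|.
  (* For [i] above [q] both sides vanish. For [i] below the size of [S] the integer difference is
     negative, so [binz] is 0, while the count is a binomial with too large a lower index. *)
  have [iq|qi] := leqP i q; last first.
    rewrite [RHS]eq_card0 => [|A]; last first.
      rewrite !inE; apply/negbTE/negP => /andP[/eqP cA _].
      by have := max_card (mem A); rewrite cA card_ord leqNgt qi.
    rewrite subzn; last lia.
    by rewrite /binz bin_small //; lia.
  rewrite card_superset_faces //; have [Si|iS] := leqP #|S| i.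
    rewrite subzn // /binz -bin_sub; last lia.
    by congr 'C(_, _); lia.
  rewrite bin_small; last lia.
  by case E: (_ - _) => [b|b] //; lia.
rewrite -[q in RHS]card_ord -card_draws addnC.
rewrite -[RHS](cardsID [set A : {set 'I_q} | S \subset A]).
by congr (_ + _)%N; apply: eq_card => A; rewrite !inE // andbC.
Qed.

(** The larger set is contained in fewer faces: by symmetry both binomials get lower index [q - i],
    and they grow with the upper index. *)
Lemma rank_pivot_leq S S' i : (#|S| <= #|S'|)%N ->
  (rank (subcomplex (@taylor_diff_pivot k n q m S) i)
     <= rank (subcomplex (@taylor_diff_pivot k n q m S') i))%N.
Proof.
move=> SS'; have := rank_pivot S i; rewrite -(rank_pivot S' i).
suff : (binz (q - #|S'|) (i%:Z - #|S'|%:Z)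
    <= binz (q - #|S|) (i%:Z - #|S|%:Z))%N.
  lia.
have S'q : (#|S'| <= q)%N by rewrite -[leqRHS]card_ord max_card.
have [S'i|iS'] := leqP #|S'| i; last by case E: (_ - _) => [b|b] //; lia.
rewrite !subzn /binz ?(leq_trans SS') //.
have [iq|qi] := leqP i q; last by rewrite bin_small //; lia.
rewrite -[leqLHS]bin_sub; last lia.
rewrite -[leqRHS]bin_sub; last lia.
have -> : (q - #|S'| - (i - #|S'|) = q - #|S| - (i - #|S|))%N by lia.
by apply: leq_bin2l; lia.
Qed.

(** * Minimal generators and Scarf witnesses *)

Lemma lepm_anti (u v : 'X_{1..n}) : (u <= v)%MM && (v <= u)%MM -> u = v.
Proof.
move=> /andP[/mnm_lepP uv /mnm_lepP vu]; apply/mnmP => h.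
by apply/anti_leq; rewrite uv vu.
Qed.

(** Otherwise the term of [j] could be absorbed into the coefficient of [i], and the generators
    other than [m j] would still generate [I]. *)
Lemma minimal_generator_dvd (I : {pred Q}) i j :
  minimal_monomial_generators m I -> (m i <= m j)%MM -> i = j.
Proof.
move=> [genI minI] ij; apply/eqP; apply/contraT => ijN.
case: (minI (setT :\ j)); first by rewrite properD1 ?inE.
move=> p; split=> [/genI[c pE]|[c pE]].
  exists (fun h => c h + (if h == i then c j * 'X_[m j - m i] else 0)).
  under eq_bigr => h _ do rewrite mulrDl.
  rewrite big_split /= pE (big_setD1 j) ?inE //= addrC; congr (_ + _).
  rewrite (bigD1 i) /=; last by rewrite !inE ijN.
  rewrite eqxx -mulrA -mpolyXD submK // big1 ?addr0 // => h /andP[_ /negPf->].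
  by rewrite mul0r.
apply/genI; exists (fun h => if h == j then 0 else c h).
rewrite (big_setD1 j) ?inE //= eqxx mul0r add0r pE.
by apply: eq_bigr => h; rewrite !inE => /andP[/negPf->].
Qed.

(** The structure [idealr] makes [I] proper, so no generator is 1; this excludes an empty set
    sharing its lcm with a nonempty one. If [A] is a singleton, the generators of [B] divide its
    generator, so minimality leaves only [A] itself or the empty set for [B]. *)
Lemma scarf_witness_ge2 (I : idealr Q) t :
  minimal_monomial_generators m (I : {pred Q}) -> scarf_witness m t ->
  (2 <= t)%N.
Proof.
move=> minI /existsP[A /existsP[B /and3P[AB /eqP cA /eqP mAB]]].
have dvd j : j \in B -> (m j <= lcm_set m A)%MM.
  by move=> jB; rewrite mAB le_lcm_set.
have m_neq0 j : ~~ (m j <= 0)%MM.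
  apply/negP => j0; have m0 : m j = 0%MM.
    by apply/mnmP => h; move/mnm_lepP/(_ h): j0; rewrite mnm0E leqn0 => /eqP.
  have : 1 \in (I : {pred Q}).
    apply/(minI.1); exists (fun h => (h == j)%:R).
    rewrite (bigD1 j) ?inE //= eqxx m0 mpolyX0 mulr1 big1 ?addr0 // => h.
    by case/andP => _ /negPf->; rewrite mul0r.
  by rewrite idealr1.
case: t cA => [|[|//]] cA.
  have A0 : A = set0 by apply/eqP; rewrite -cards_eq0 cA.
  case/eqP: AB; rewrite A0; have [-> //|[j jB]] := set_0Vmem B.
  by have := dvd j jB; rewrite A0 /lcm_set big_set0 (negPf (m_neq0 j)).
have /cards1P[j Aj] : #|A| == 1%N by rewrite cA.
have BA h : h \in B -> h = j.
  move/dvd; rewrite Aj /lcm_set big_set1E mlcm0.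
  exact: minimal_generator_dvd minI.
case/eqP: AB; rewrite Aj; apply/eqP; rewrite eqEsubset sub1set andbC.
apply/andP; split; first by apply/subsetP => h /BA ->; rewrite inE.
have [B0|[h hB]] := set_0Vmem B; last by rewrite -(BA h hB).
have /le_lcm_set : j \in A by rewrite Aj set11.
by rewrite mAB B0 /lcm_set big_set0 (negPf (m_neq0 j)).
Qed.

(* A witness [A], [B] of minimal size with [B] a subset of [A] would make [B]
   a smaller witness. *)
Lemma scarf_number_dvd l : scarf_number m = Some l ->
  exists S, #|S| = l /\ exists2 j, j \notin S & (m j <= lcm_set m S)%MM.
Proof.
move=> sl; have := scarf_numberP m; rewrite sl => -[wl minl].
have /existsP[A /existsP[B /and3P[AB /eqP cA /eqP mAB]]] := wl.
exists A; split=> //; have [BA|/subsetPn[j jB jA]] := boolP (B \subset A).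
  have ltBA : (#|B| < #|A|)%N.
    by apply: proper_card; rewrite properEneq eq_sym AB BA.
  suff /minl : scarf_witness m #|B| by rewrite -cA leqNgt ltBA.
  apply/existsP; exists B; apply/existsP; exists A.
  by rewrite eq_sym AB mAB !eqxx.
by exists j; rewrite // mAB le_lcm_set.
Qed.

(** Adjoining [j] does not change the lcm, so [j |: S] is the second set. *)
Lemma dvd_scarf_witness S j :
  j \notin S -> (m j <= lcm_set m S)%MM -> scarf_witness m #|S|.
Proof.
move=> jS jle; apply/existsP; exists S; apply/existsP; exists (j |: S).
rewrite eqxx /=; apply/andP; split.
  by apply: contraNneq jS => ->; rewrite setU11.
apply/eqP/lepm_anti; rewrite lcm_setS ?subsetUr // lcm_setU1_le jle.
exact: lepm_refl.
Qed.
End Taylor.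

Theorem corollary3p8 (k : fieldType) (n q : nat)
    (I : idealr {mpoly k[n]}) (m : 'I_q -> 'X_{1..n}) (l : nat) :
  minimal_monomial_generators m I ->
  scarf_number m = Some l ->
  exists i_ : 'I_l -> 'I_q,
    [/\ {homo i_ : a b / (a < b)%N},
        pivot_resolution m I (pivot k m i_)
      & forall F : complex {mpoly k[n]}, pivot_resolution m I F ->
        forall i : nat,
          [/\ 'C(q, i)%:Z - (binz (q - l) (i%:Z - l%:Z))%:Z
                = (rank (pivot k m i_ i))%:Z,
              (rank (pivot k m i_ i) <= rank (F i))%N
            & (rank (F i) <= 'C(q, i))%N]].
Proof.
move=> minI sl; have [S [cS [j jS jle]]] := scarf_number_dvd sl.
have [wl minl] : scarf_witness m l /\ forall t, scarf_witness m t -> (l <= t)%N.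
  by have := scarf_numberP m; rewrite sl.
have l2 := scarf_witness_ge2 minI wl.
have [f f_homo fS] := increasing_enum cS.
have rank_f i := rank_pivot k m S i; rewrite cS in rank_f.
exists f; split=> //.
  split; first exact: PivotSub.
  by rewrite /pivot fS; apply: pivot_free_resolution jle => //;
    [case: minI|rewrite cS].
rewrite /pivot fS => F [pF resF] i; split; first by rewrite -rank_f; lia.
  case: F / pF resF => [_|l' g l'2 g_homo resF].
    by rewrite rank_taylor -rank_f leq_addr.
  rewrite /pivot in resF *; set S' := imset _ _ in resF *.
  have cS' : #|S'| = l' by exact: card_increasing_image.
  (* The set defining a pivot resolution is a Scarf witness, so it has at least [l] elements, and
     larger sets give larger ranks. *)
  have [|h hS' hle] := pivot_resolution_dvd _ resF; first by rewrite cS'.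
  have := minl _ (dvd_scarf_witness hS' hle); rewrite cS' => ll'.
  by apply: rank_pivot_leq; rewrite cS cS'.
case: F / pF resF => [_|l' g _ _ _]; first by rewrite rank_taylor.
by rewrite -(rank_pivot k m [set g j | j : 'I_l'] i) leq_addr.
Qed.
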